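(* Let $G$ and $H$ be finite simple graphs, let $\mathscr{C}=\{C_1,\dots,C_q\}$ be a clique cover of $G$ (so $|\mathscr{C}|=q$), and let $U\subseteq V(H)$. Then $$I(G^{\mathscr{C}}\star H^U;x)=I^q(H;x)\,I\!\left(G;\frac{x\,I(H-U;x)}{I(H;x)}\right).$$
   Context: For a finite simple graph $G$, $i_k(G)$ is the number of independent sets of size $k$ in $G$ ($i_0(G)=1$), $\alpha(G)$ is the size of a maximum independent set, and the independence polynomial is $I(G;x)=\sum_{k=0}^{\alpha(G)} i_k(G)x^k$. For $U\subseteq V(H)$, $H-U$ is the subgraph induced on $V(H)\setminus U$. A clique cover of $G$ is a spanning subgraph of $G$ each of whose connected components is a clique; we view it as the collection $\mathscr{C}=\{C_1,\dots,C_q\}$ of these cliques, which partition $V(G)$. The clique cover product $G^{\mathscr{C}}\star H^U$ is the graph obtained from $G$ by, for each clique $C_i\in\mathscr{C}$, adding a new disjoint copy of $H$ and joining every vertex of $C_i$ to every vertex of the copy of $U$ in that copy of $H$. $I^q(H;x)$ denotes $(I(H;x))^q$. *)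

(* Defs.v *)
From mathcomp Require Import all_boot all_order all_algebra.

Set Implicit Arguments.
Unset Strict Implicit.
Unset Printing Implicit Defensive.

Import GRing.Theory.
Local Open Scope ring_scope.

Record sgraph := SGraph {
  vertex :> finType;
  adj : rel vertex;
  adj_sym : symmetric adj;
  adj_irrefl : irreflexive adj }.

Definition indep (G : sgraph) (S : {set G}) : bool :=
  [forall u in S, forall v in S, ~~ adj u v].

Definition indep_count (G : sgraph) (k : nat) : nat :=
  #|[set S : {set G} | indep S & #|S| == k]|.

Definition indep_number (G : sgraph) : nat :=
  \max_(S : {set G} | indep S) #|S|.

Definition indep_poly (G : sgraph) : {poly int} :=
  \sum_(0 <= k < (indep_number G).+1) (indep_count G k)%:R *: 'X^k.

(* The value I(G; y) at a point y of an arbitrary ring. *)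
Definition indep_eval (R : nzRingType) (G : sgraph) (y : R) : R :=
  (map_poly intr (indep_poly G)).[y].

Section Induced.
Variables (G : sgraph) (S : {set G}).

Definition induced_adj : rel {v : G | v \in S} :=
  fun u v => adj (val u) (val v).

Lemma induced_adj_sym : symmetric induced_adj.
Proof. by move=> u v; apply: adj_sym. Qed.

Lemma induced_adj_irrefl : irreflexive induced_adj.
Proof. by move=> u; apply: adj_irrefl. Qed.

Definition induced : sgraph := SGraph induced_adj_sym induced_adj_irrefl.
End Induced.

Definition delete (H : sgraph) (U : {set H}) : sgraph := induced (~: U).

Definition clique (G : sgraph) (K : {set G}) : bool :=
  [forall u in K, forall v in K, (u != v) ==> adj u v].

(* The connected components of the spanning subgraph, as vertex sets;
   [partition] requires them to be nonempty. *)
Definition clique_cover (G : sgraph) (C : {set {set G}}) : bool :=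
  partition C [set: G] && [forall K in C, clique K].

(* inl v is a vertex v of G; inr (K, h) is the vertex h of the copy of H
   attached to the clique K. *)
Section CliqueCoverProduct.
Variables (G : sgraph) (C : {set {set G}}) (H : sgraph) (U : {set H}).

Definition ccprod_vertex : finType := (G + {K : {set G} | K \in C} * H)%type.

Definition ccprod_adj : rel ccprod_vertex := fun a b =>
  match a, b with
  | inl u, inl v => adj u v
  | inl u, inr (K, h) => (u \in val K) && (h \in U)
  | inr (K, h), inl u => (u \in val K) && (h \in U)
  | inr (K, h), inr (L, k) => (K == L) && adj h k
  end.

Lemma ccprod_adj_sym : symmetric ccprod_adj.
Proof.
by case=> [u|[K h]] [v|[L k]] //=; [apply: adj_sym | rewrite eq_sym adj_sym].
Qed.

Lemma ccprod_adj_irrefl : irreflexive ccprod_adj.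
Proof. by case=> [u|[K h]] /=; rewrite adj_irrefl ?andbF. Qed.

Definition ccprod : sgraph := SGraph ccprod_adj_sym ccprod_adj_irrefl.
End CliqueCoverProduct.

(* Main.v *)
(* An independent set of the product is an independent set S of G together with
   an independent set of each copy of H, which has to avoid U exactly when the
   clique K of that copy meets S. Hence S contributes x^|S| times the product
   over K of I(H-U) or I(H). Since K meets S at most once, its factor is
   I(H) (I(H-U)/I(H))^|K :&: S|, and these exponents add up to |S| because the
   cliques partition the vertices of G. *)
Require Import Defs.
From mathcomp Require Import all_boot all_order all_algebra.

Set Implicit Arguments.
Unset Strict Implicit.
Unset Printing Implicit Defensive.

Import GRing.Theory.
Local Open Scope ring_scope.

Lemma card_le_indep_number (G : sgraph) (S : {set G}) :
  indep S -> (#|S| < (indep_number G).+1)%N.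
Proof. by move=> iS; rewrite ltnS /indep_number (bigmax_sup S). Qed.

(** Grouping the independent sets by size gives [indep_count G k] equal terms for each [k]. Sums
    over sets replace coefficients from here on. *)
Lemma indep_evalE (R : comNzRingType) (G : sgraph) (y : R) :
  indep_eval G y = \sum_(S : {set G} | indep S) y ^+ #|S|.
Proof.
(* [inord] falls back to 0 out of range; by [card_le_indep_number] this never happens for an
   independent set. *)
pose card_ord (S : {set G}) : 'I_(indep_number G).+1 := inord #|S|.
rewrite /indep_eval /indep_poly raddf_sum horner_sum /= big_mkord.
rewrite [RHS](partition_big card_ord xpredT) //=.
apply: eq_bigr => k _; rewrite map_polyZ map_polyXn hornerZ hornerXn rmorph_nat.
rewrite mulr_natl /indep_count -sumr_const.
apply: eq_big => [S|S]; rewrite inE.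
  apply: andb_id2l => iS.
  by rewrite -(inj_eq val_inj) /= inordK ?card_le_indep_number.
by case/andP=> _ /eqP->.
Qed.

Lemma indep_polyE (G : sgraph) :
  indep_poly G = \sum_(S : {set G} | indep S) 'X^#|S|.
Proof.
(* Evaluation at ['X] in [{poly int}] returns the polynomial itself. *)
rewrite -indep_evalE /indep_eval [indep_poly G in RHS]/indep_poly.
rewrite raddf_sum horner_sum /=; apply: eq_bigr => k _.
by rewrite map_polyZ map_polyXn hornerZ hornerXn rmorph_nat scaler_nat mulr_natl.
Qed.

Lemma indepP (G : sgraph) (S : {set G}) :
  reflect {in S &, forall u v, ~~ adj u v} (indep S).
Proof.
apply: (iffP forall_inP) => [iS u v uS vS | iS u uS].
  by move/forall_inP: (iS u uS); apply.
by apply/forall_inP => v; apply: iS.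
Qed.

Lemma indep0 (G : sgraph) : indep (set0 : {set G}).
Proof. by apply/indepP => u v; rewrite inE. Qed.

(** The empty set makes the constant coefficient 1. This permits cancelling I(H) in the fraction
    field. *)
Lemma indep_poly_neq0 (G : sgraph) : indep_poly G != 0.
Proof.
apply/eqP => /(congr1 (fun p => p.[0])); rewrite horner0 indep_polyE horner_sum.
rewrite (bigD1 set0) ?indep0 //= cards0 expr0 hornerC big1 ?addr0 //.
by move=> S /andP[_]; rewrite hornerXn expr0n cards_eq0 => /negPf->.
Qed.

(** Images under [val] identify the independent sets of the induced graph with those of [H] inside
    [A]. *)
Lemma indep_poly_induced (H : sgraph) (A : {set H}) :
  indep_poly (induced A) =
    \sum_(T : {set H} | indep T && (T \subset A)) 'X^#|T|.
Proof.
rewrite indep_polyE.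
rewrite [RHS](reindex_onto (fun T : {set induced A} => val @: T)
                           (fun T => val @^-1: T)) /=.
  apply: eq_big => [T|T _]; last by rewrite card_imset //; apply: val_inj.
  have -> : val @^-1: (val @: T) == T.
    by apply/eqP/setP=> x; rewrite inE (mem_imset _ _ val_inj).
  have -> : val @: T \subset A by apply/subsetP=> _ /imsetP[x _ ->]; apply: valP.
  rewrite !andbT; apply/indepP/indepP => [iT _ _ /imsetP[u uT ->] /imsetP[v vT ->] | iT u v uT vT].
    exact: iT.
  by apply: iT; apply: imset_f.
move=> T /andP[_ /subsetP sTA]; apply/setP=> x; apply/imsetP/idP.
  by case=> y; rewrite inE => yT ->.
by move=> xT; exists (exist _ x (sTA x xT)); rewrite ?inE.
Qed.

Lemma clique_indep_card_le1 (G : sgraph) (K S : {set G}) :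
  clique K -> indep S -> (#|K :&: S| <= 1)%N.
Proof.
move=> cK /indepP iS; rewrite leqNgt; apply/negP => /card_gt1P[u [v []]].
rewrite !inE => /andP[uK uS] /andP[vK vS] uv.
move/forall_inP: cK => /(_ u uK) /forall_inP /(_ v vK); rewrite uv /=.
by rewrite (negPf (iS _ _ uS vS)).
Qed.

Section ProductSets.
Variables (G H : sgraph) (C : {set {set G}}) (U : {set H}).
Implicit Types (S : {set G}) (f : {ffun {K : {set G} | K \in C} -> {set H}}).

Definition ccprod_set (p : {set G} * {ffun {K : {set G} | K \in C} -> {set H}}) :
    {set ccprod C U} :=
  [set a | match a with inl v => v \in p.1 | inr (K, h) => h \in p.2 K end].

Lemma ccprod_set_bij : bijective ccprod_set.
Proof.
exists (fun W : {set ccprod C U} => ([set v | inl v \in W], [ffun K => [set h | inr (K, h) \in W]])).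
  move=> [S f]; congr (_, _); first by apply/setP=> v; rewrite !inE.
  by apply/ffunP=> K; rewrite ffunE; apply/setP=> h; rewrite !inE.
by move=> W; apply/setP=> -[v|[K h]]; rewrite inE /= ?ffunE inE.
Qed.

Lemma card_ccprod_set S f :
  #|ccprod_set (S, f)| = (#|S| + \sum_K #|f K|)%N.
Proof.
rewrite -sum1_card big_mkcond big_sumType /=; congr (_ + _)%N.
  by rewrite -sum1_card [RHS]big_mkcond; apply: eq_bigr => v _; rewrite inE.
under [RHS]eq_bigr do rewrite -sum1_card big_mkcond /=.
by rewrite pair_bigA; apply: eq_bigr => -[K h] _; rewrite inE.
Qed.

(** For fixed [S] the condition on one copy does not involve the other copies, so the admissible
    choices form a [family]. *)
Definition compatible S (K : {K : {set G} | K \in C}) : pred {set H} :=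
  fun T => indep T && ((val K :&: S != set0) ==> (T \subset ~: U)).

(** Edges inside [G], inside one copy, and between a clique and its copy of [U] give the three
    conditions; different copies are not joined. *)
Lemma indep_ccprod_set S f :
  indep (ccprod_set (S, f)) = indep S && (f \in family (compatible S)).
Proof.
apply/indepP/andP => [iW | [/indepP iS /familyP fQ]].
  split; first by apply/indepP=> u v uS vS; apply: (iW (inl u) (inl v)); rewrite inE.
  apply/familyP=> K; rewrite unfold_in; apply/andP; split.
    apply/indepP=> h k hT kT; have := iW (inr (K, h)) (inr (K, k)).
    by rewrite !inE /= eqxx; apply.
  apply/implyP=> /set0Pn[v]; rewrite inE => /andP[vK vS].
  apply/subsetP=> h hT; rewrite inE.
  by have := iW (inl v) (inr (K, h)); rewrite !inE /= vK; apply.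
(* Serves the edges between [G] and a copy, in both orders. *)
have avoidU u K h : u \in S -> h \in f K -> ~~ ((u \in val K) && (h \in U)).
  move=> uS hT; apply/andP=> -[uK hU]; have /andP[_ /implyP sT] := fQ K.
  have /sT/subsetP/(_ h hT) : val K :&: S != set0 by apply/set0Pn; exists u; rewrite inE uK.
  by rewrite inE hU.
move=> [u|[K h]] [v|[L k]]; rewrite !inE /=; [exact: iS | exact: avoidU | |].
  by move=> hT vS; apply: avoidU.
move=> hT kT; apply/andP=> -[/eqP eKL]; rewrite -eKL in kT.
by have /andP[/indepP iT _] := fQ K; apply: (negP (iT _ _ hT kT)).
Qed.

Lemma indep_poly_ccprod :
  indep_poly (ccprod C U) =
    \sum_(S : {set G} | indep S) 'X^#|S| *
      \prod_(K in C) (if K :&: S != set0 then indep_poly (delete U) else indep_poly H).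
Proof.
rewrite indep_polyE (reindex ccprod_set) /=; last exact/onW_bij/ccprod_set_bij.
rewrite (eq_bigl (fun p => indep p.1 && (p.2 \in family (compatible p.1)))); last first.
  by case=> S f; apply: indep_ccprod_set.
rewrite (eq_bigr (fun p => 'X^#|ccprod_set (p.1, p.2)|)); last by case.
rewrite -(pair_big_dep (fun S => indep S) (fun S f => f \in family (compatible S))
           (fun S f => 'X^#|ccprod_set (S, f)|)) /=.
apply: eq_bigr => S _; under eq_bigr do rewrite card_ccprod_set exprD expr_sum.
(* Distributivity turns the sum over families into a product over cliques of sums over sets of
   [H]. *)
rewrite -big_distrr -(bigA_distr_big_dep _ (fun _ (T : {set H}) => 'X^#|T|)) /= [in RHS]big_sub.
congr (_ * _); apply: eq_bigr => K _; rewrite /compatible.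
case: ifP => _; first by rewrite indep_poly_induced.
by rewrite indep_polyE; apply: eq_bigl => T; rewrite andbT.
Qed.

End ProductSets.

Theorem theorem1p1 (G H : sgraph) (C : {set {set G}}) (U : {set H}) (q : nat)
    (hC : clique_cover C) (hq : #|C| = q) :
  tofrac (indep_poly (ccprod C U)) =
    tofrac (indep_poly H) ^+ q *
    indep_eval G (tofrac 'X * tofrac (indep_poly (delete U)) / tofrac (indep_poly H))
  :> {fraction {poly int}}.
Proof.
have [Cpart Ccliques] := andP hC.
rewrite indep_poly_ccprod indep_evalE rmorph_sum mulr_sumr /=.
apply: eq_bigr => S iS; rewrite rmorphM rmorphXn rmorph_prod /=.
set a := tofrac (indep_poly (delete U)); set b := tofrac (indep_poly H).
have b0 : b != 0 by rewrite tofrac_eq0 indep_poly_neq0.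
have cardS : #|S| = (\sum_(K in C) #|K :&: S|)%N.
  (* Inserts the trivial condition [v \in [set: G]], the set that [C] partitions. *)
  rewrite -sum1_card -[LHS](eq_bigl _ _ (fun v => congr1 (andb^~ _) (in_setT v))).
  rewrite (set_partition_big_cond _ Cpart) /=; apply: eq_bigr => K _.
  by rewrite -sum1_card; apply: eq_bigl => v; rewrite inE.
rewrite -mulrA exprMn mulrCA; congr (_ * _).
(* Each clique receives one of the [q] factors [b] and its share of the exponent [#|S|]. *)
rewrite cardS expr_sum -hq -prodr_const -big_split /=.
apply: eq_bigr => K KC.
have := clique_indep_card_le1 (forall_inP Ccliques K KC) iS.
(* Sizes 0 and 1 remain, with factors [b] and [b * (a / b) = a]. *)
rewrite -cards_eq0; case: #|_| => [|[|//]] _ /=; first by rewrite mulr1.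
by rewrite expr1 mulrC divfK.
Qed.
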